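(* Let $A$ be a finite-dimensional left-symmetric algebra over a field $\mathbb{F}$ of characteristic zero satisfying $(x\cdot y)\cdot z=(y\cdot x)\cdot z$ for all $x,y,z\in A$. Then $A$ is an extension of a commutative associative algebra by a complete left-symmetric algebra satisfying the same identity; that is, there is a two-sided ideal $I$ of $A$ such that $I$ is a complete left-symmetric algebra satisfying $(x\cdot y)\cdot z=(y\cdot x)\cdot z$ for all $x,y,z\in I$, and the quotient algebra $A/I$ is commutative and associative.
   Context: A left-symmetric algebra over $\mathbb{F}$ is a vector space $A$ over $\mathbb{F}$ with a bilinear product $\cdot$ such that $(x\cdot y)\cdot z-x\cdot(y\cdot z)=(y\cdot x)\cdot z-y\cdot(x\cdot z)$ for all $x,y,z\in A$. A left-symmetric algebra $I$ is complete if the right multiplication $R_x:I\to I$, $y\mapsto y\cdot x$, is nilpotent for every $x\in I$. Algebras are not assumed unital, and the zero algebra is allowed. *)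

(* Defs.v *)
From HB Require Import structures.
From mathcomp Require Import all_boot all_algebra.

Set Implicit Arguments.
Unset Strict Implicit.
Unset Printing Implicit Defensive.

Import GRing.Theory.
Local Open Scope ring_scope.
Local Open Scope quotient_scope.

(* An algebra over F, not assumed unital or associative, is an F-module V
   together with a product [mul : V -> V -> V] satisfying [bilinear_product]. *)
Section Algebras.
Variables (F : fieldType) (V : lmodType F).
Implicit Type mul : V -> V -> V.

Definition bilinear_product mul : Prop := bilinear_for *:%R *:%R mul.

Definition left_symmetric mul : Prop := forall x y z,
  mul (mul x y) z - mul x (mul y z) = mul (mul y x) z - mul y (mul x z).

Definition left_symmetric_algebra mul : Prop :=
  bilinear_product mul /\ left_symmetric mul.

Definition left_commuting_identity mul : Prop :=
  forall x y z, mul (mul x y) z = mul (mul y x) z.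

Definition right_multiplication mul (x : V) : V -> V := fun y => mul y x.

Definition nilpotent_operator (f : V -> V) : Prop :=
  exists n : nat, forall v, iter n f v = 0.

Definition complete_left_symmetric_algebra mul : Prop :=
  left_symmetric_algebra mul /\
  forall x, nilpotent_operator (right_multiplication mul x).

Definition commutative_associative_algebra mul : Prop :=
  [/\ bilinear_product mul, commutative mul & associative mul].

End Algebras.

Definition two_sided_ideal (F : fieldType) (A : vectType F)
    (mul : A -> A -> A) (I : {vspace A}) : Prop :=
  forall a x, x \in I -> mul a x \in I /\ mul x a \in I.

(* The product of A restricted to I, on the vector space [subvs_of I]. It is
   meaningful when I is closed under [mul]; see [vsval_restr_product]. *)
Definition restr_product (F : fieldType) (A : vectType F)
    (I : {vspace A}) (mul : A -> A -> A) (u v : subvs_of I) : subvs_of I :=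
  vsproj I (mul (vsval u) (vsval v)).

Arguments restr_product {F A} I mul u v.

Lemma vsval_restr_product (F : fieldType) (A : vectType F)
    (mul : A -> A -> A) (I : {vspace A}) (u v : subvs_of I) :
  two_sided_ideal mul I ->
  vsval (restr_product I mul u v) = mul (vsval u) (vsval v).
Proof.
by move=> idI; rewrite vsprojK //; case: (idI (vsval u) _ (subvsP v)).
Qed.

(* The quotient vector space A / I: MathComp's quotient Z-module [Quotient.quot I],
   equipped with the induced scaling. *)
Definition vquot (F : fieldType) (A : vectType F) (I : {vspace A}) : Type :=
  Quotient.quot I.

Section QuotientSpace.
Variables (F : fieldType) (A : vectType F) (I : {vspace A}).
Local Notation Q := (vquot I).

HB.instance Definition _ := GRing.Zmodule.on Q.
HB.instance Definition _ := EqQuotient.on Q.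

Definition vquot_pi (x : A) : Q := \pi_Q x.

Lemma vquot_piP x y : (vquot_pi x = vquot_pi y) <-> (x - y \in I).
Proof. by split; [move=> e; rewrite Quotient.idealrBE; apply/eqP
                 | rewrite Quotient.idealrBE => /eqP]. Qed.

Lemma vquot_reprK (q : Q) : vquot_pi (repr q) = q.
Proof. exact: reprK. Qed.

Lemma vquot_piD x y : vquot_pi (x + y) = vquot_pi x + vquot_pi y.
Proof. exact: (raddfD (\pi_(Quotient.quot I))). Qed.

Definition vquot_scale (a : F) (q : Q) : Q := vquot_pi (a *: repr q).

Lemma vquot_scale_pi a x : vquot_scale a (vquot_pi x) = vquot_pi (a *: x).
Proof. by apply/vquot_piP; rewrite -scalerBr memvZ //; apply/vquot_piP/vquot_reprK. Qed.

Fact vquot_scaleA a b q :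
  vquot_scale a (vquot_scale b q) = vquot_scale (a * b) q.
Proof. by rewrite -(vquot_reprK q) !vquot_scale_pi scalerA. Qed.

Fact vquot_scale1 : left_id 1 vquot_scale.
Proof. by move=> q; rewrite -(vquot_reprK q) vquot_scale_pi scale1r. Qed.

Fact vquot_scaleDr : right_distributive vquot_scale +%R.
Proof.
move=> a q r; rewrite -(vquot_reprK q) -(vquot_reprK r).
by rewrite -vquot_piD !vquot_scale_pi scalerDr vquot_piD.
Qed.

Fact vquot_scaleDl q : {morph vquot_scale^~ q : a b / a + b}.
Proof.
by move=> a b; rewrite -(vquot_reprK q) !vquot_scale_pi scalerDl vquot_piD.
Qed.

HB.instance Definition _ := GRing.Zmodule_isLmodule.Build F Q
  vquot_scaleA vquot_scale1 vquot_scaleDr vquot_scaleDl.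

(* (x + I)(y + I) := xy + I, computed on canonical representatives. It does not
   depend on them when I is a two-sided ideal; see [vquot_product_pi]. *)
Definition quot_product (mul : A -> A -> A) (q r : Q) : Q :=
  vquot_pi (mul (repr q) (repr r)).

Lemma vquot_product_pi (mul : A -> A -> A) x y :
  bilinear_product mul -> two_sided_ideal mul I ->
  quot_product mul (vquot_pi x) (vquot_pi y) = vquot_pi (mul x y).
Proof.
move=> [linl linr] idI; apply/vquot_piP.
have mulBl u v w : mul (u - v) w = mul u w - mul v w.
  by have /= := linl w (-1) v u; rewrite !scaleN1r [u - v]addrC [RHS]addrC.
have mulBr u v w : mul u (v - w) = mul u v - mul u w.
  by have /= := linr u (-1) w v; rewrite !scaleN1r [v - w]addrC [RHS]addrC.
set x' := repr _; set y' := repr _.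
have Ix : x' - x \in I by apply/vquot_piP/vquot_reprK.
have Iy : y' - y \in I by apply/vquot_piP/vquot_reprK.
rewrite -[_ - _](subrKA (mul x y')) -mulBl -mulBr memvD //.
  by case: (idI y' _ Ix).
by case: (idI x _ Iy).
Qed.

End QuotientSpace.

Arguments quot_product {F A} I mul q r.

(* Main.v *)
(* Take I to be the left annihilator {x | x A = 0}. The identity says that it
   contains every commutator, so A / I is commutative; I A = 0 and
   (a x) z = (x a) z = 0 make I a two-sided ideal, on which all products vanish,
   so I is trivially complete. Together with the identity, left symmetry says
   that left multiplications commute, and a commutative algebra with this
   property is associative. *)
Require Import Defs.
From HB Require Import structures.
From mathcomp Require Import all_boot all_algebra.
Import GRing.Theory.
Local Open Scope ring_scope.

Section BilinearProduct.
Variables (F : fieldType) (A : vectType F) (mul : A -> A -> A).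
Hypothesis bil : bilinear_product mul.

Lemma bilinear_product_linearl y : linear (mul^~ y).
Proof. by case: bil. Qed.

Lemma bilinear_product_linearr x : linear (mul x).
Proof. by case: bil. Qed.

(** Bundling the one-sided multiplications as linear maps gives a product that is bilinear only by
    hypothesis access to kernels and to the generic lemmas on linear maps. *)
Definition mull x : {linear A -> A} :=
  HB.pack (mul x) (GRing.isLinear.Build F A A *:%R (mul x)
    (bilinear_product_linearr x)).

Definition mulr y : {linear A -> A} :=
  HB.pack (mul^~ y) (GRing.isLinear.Build F A A *:%R (mul^~ y)
    (bilinear_product_linearl y)).

Lemma mul0v y : mul 0 y = 0.
Proof. exact: (linear0 (mulr y)). Qed.

Lemma mulvBl x y z : mul (x - y) z = mul x z - mul y z.
Proof. exact: (linearB (mulr z)). Qed.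

(** Intersecting kernels over a basis only keeps the intersection finite, so that it is a
    [{vspace A}] by construction. *)
Definition left_annihilator : {vspace A} :=
  (\bigcap_(i < \dim {:A}) lker (linfun (mulr (vbasis {:A})`_i)))%VS.

Lemma left_annihilatorP x :
  reflect (forall y, mul x y = 0) (x \in left_annihilator).
Proof.
rewrite memvE; apply: (iffP subv_bigcapP) => [xI y | x0 i _]; last first.
  by rewrite -memvE memv_ker lfunE /= x0.
(* By linearity in [y], vanishing on the basis vectors is enough. *)
rewrite (coord_vbasis (memvf y)) -[mul x _]/(mull x _) linear_sum big1 //.
move=> i _; rewrite linearZ /=.
by have := xI i isT; rewrite -memvE memv_ker lfunE /= => /eqP ->; rewrite scaler0.
Qed.

Lemma vquot_piZ (I : {vspace A}) a x :
  vquot_pi I (a *: x) = a *: vquot_pi I x.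
Proof. by rewrite -vquot_scale_pi. Qed.

Lemma quot_product_bilinear (I : {vspace A}) :
  two_sided_ideal mul I -> bilinear_product (quot_product I mul).
Proof.
move=> idI; split=> p a q r /=;
  rewrite -(vquot_reprK p) -(vquot_reprK q) -(vquot_reprK r);
  rewrite -vquot_piZ -vquot_piD !vquot_product_pi // -vquot_piZ -vquot_piD.
  by rewrite bilinear_product_linearl.
by rewrite bilinear_product_linearr.
Qed.

Hypothesis idA : left_commuting_identity mul.

Lemma left_annihilator_ideal : two_sided_ideal mul left_annihilator.
Proof.
move=> a x /left_annihilatorP x0; split; last by rewrite x0 mem0v.
by apply/left_annihilatorP => y; rewrite idA x0 mul0v.
Qed.

Lemma commutator_left_annihilator x y : mul x y - mul y x \in left_annihilator.
Proof. by apply/left_annihilatorP => z; rewrite mulvBl idA subrr. Qed.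

Lemma restr_left_annihilator0 u v : restr_product left_annihilator mul u v = 0.
Proof.
apply: val_inj; rewrite /= vsval_restr_product ?linear0.
  (* The left factor alone suffices: [vsval u] kills all of [A]. *)
  by apply/left_annihilatorP/subvsP.
exact: left_annihilator_ideal.
Qed.

End BilinearProduct.

Arguments left_annihilator {F A mul} bil.

Lemma zero_product_complete (F : fieldType) (V : lmodType F)
    (mul : V -> V -> V) :
  (forall x y, mul x y = 0) -> complete_left_symmetric_algebra mul.
Proof.
move=> mul0; split; last by move=> x; exists 1%N => y; exact: mul0.
split; last by move=> x y z; rewrite !mul0.
by split=> x a y z; rewrite /= !mul0 scaler0 addr0.
Qed.

Lemma left_multiplication_comm (F : fieldType) (V : lmodType F)
    (mul : V -> V -> V) :
  left_symmetric mul -> left_commuting_identity mul ->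
  left_commutative mul.
(* The identity makes the first terms of the two associators equal, so they cancel. *)
Proof. by move=> ls idV x y z; have := ls x y z; rewrite idV => /addrI/oppr_inj. Qed.

Theorem corollary27 (F : fieldType) (charF0 : [pchar F] =i pred0)
    (A : vectType F) (mul : A -> A -> A)
    (lsaA : left_symmetric_algebra mul)
    (idA : left_commuting_identity mul) :
  exists I : {vspace A},
    [/\ two_sided_ideal mul I,
        complete_left_symmetric_algebra (restr_product I mul),
        left_commuting_identity (restr_product I mul)
      & commutative_associative_algebra (quot_product I mul)].
Proof.
case: lsaA => bil ls; pose I := left_annihilator bil; exists I.
have idI : two_sided_ideal mul I by exact: left_annihilator_ideal.
have restr0 u v : restr_product I mul u v = 0 by exact: restr_left_annihilator0.
have quotC : commutative (quot_product I mul).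
  move=> p q; rewrite -(vquot_reprK p) -(vquot_reprK q) !vquot_product_pi //.
  exact/vquot_piP/commutator_left_annihilator.
split=> //; first exact: zero_product_complete.
  by move=> x y z; rewrite !restr0.
split=> //; first exact: quot_product_bilinear.
(* Commutativity turns p(qr) = (pq)r into p(rq) = r(pq), which on representatives is left
   commutativity of [mul]. *)
move=> p q r; rewrite [RHS]quotC (quotC q r).
rewrite -(vquot_reprK p) -(vquot_reprK q) -(vquot_reprK r) !vquot_product_pi //.
by rewrite left_multiplication_comm.
Qed.
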